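(* Let $\Omega\in\mathcal B(\mathbb R^n)$, let $C\subset\overline\Omega$ be a density set of $\Omega$, and let $\mu\in\mathrm{ba}(\Omega,\mathcal B(\Omega),\mathcal L^n)$. Then $\mu\in\mathrm{Dens}_C$ if and only if there is some $\lambda\in\mathrm{ba}(\Omega,\mathcal B(\Omega),\mathcal L^n)$ with $\lambda\ge0$ and $\lambda(C_\delta\cap\Omega)>0$ for all $\delta>0$ such that $$\int_\Omega f\,d\mu\le\limsup_{\delta\downarrow0}\frac1{\lambda(C_\delta\cap\Omega)}\int_{C_\delta\cap\Omega}f\,d\lambda\qquad\text{for all }f\in L^\infty(\Omega).$$ In this case (i.e. for any such $\lambda$) the preceding inequality implies $$\liminf_{\delta\downarrow0}\frac1{\lambda(C_\delta\cap\Omega)}\int_{C_\delta\cap\Omega}f\,d\lambda\le\int_\Omega f\,d\mu\qquad\text{for all }f\in L^\infty(\Omega).$$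
   Context: $\mathcal L^n$ is Lebesgue measure on $\mathbb R^n$, $\mathcal B(\Omega)$ the Borel subsets of $\Omega$, $L^\infty(\Omega)=L^\infty(\Omega,\mathcal B(\Omega),\mathcal L^n)$. A measure on $\Omega$ means a finitely additive set function on $\mathcal B(\Omega)$ vanishing at $\emptyset$. $\mathrm{ba}(\Omega,\mathcal B(\Omega),\mathcal L^n)$ is the space of bounded real-valued finitely additive measures $\mu$ on $\mathcal B(\Omega)$ such that $\mu(A)=0$ whenever $\mathcal L^n(A)=0$; it is the dual of $L^\infty(\Omega)$ via $f\mapsto\int_\Omega f\,d\mu$ (for bounded $f$ the integral is obtained by uniform approximation with simple functions). $C_\delta$ denotes the open $\delta$-neighborhood of $C$ in $\mathbb R^n$. A set $C\subset\overline\Omega$ is a density set of $\Omega$ if $C$ is nonempty and closed in $\mathbb R^n$, $\mathcal L^n(C\cap\Omega)=0$, and $\mathcal L^n(C_\delta\cap\Omega)>0$ for all $\delta>0$. $\mathrm{Dens}_C$ is the set of all $\mu\in\mathrm{ba}(\Omega,\mathcal B(\Omega),\mathcal L^n)$ with $\mu\ge 0$ and $\mu(C_\delta\cap\Omega)=\mu(\Omega)=1$ for all $\delta>0$ (density measures at $C$). *)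

(* Defs.v *)
From HB Require Import structures.
From mathcomp Require Import all_boot all_order all_algebra.
From mathcomp Require Import all_classical all_reals all_analysis.
From mathcomp Require Import measurable_realfun lra.

Set Implicit Arguments.
Unset Strict Implicit.
Unset Printing Implicit Defensive.
Import Order.TTheory GRing.Theory Num.Theory.
Import numFieldNormedType.Exports HBSimple.
Local Open Scope classical_set_scope.
Local Open Scope ring_scope.

(* The topology of 'rV[R]_n is the product topology, so that [measurable] now
   denotes the Borel sets of R^n. *)
HB.instance Definition _ (R : realType) (n : nat) :=
  @isMeasurable.Build (sigma_display (@open 'rV[R]_n)) 'rV[R]_n <<s open >>
    (@sigma_algebra0 _ _ _) (@sigma_algebraC _ _)
    (@sigma_algebra_bigcup _ _ _).

Section lebesgue_measure_rV.
Context (R : realType).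

Definition cons_rV n (p : R * 'rV[R]_n) : 'rV[R]_n.+1 :=
  row_mx (p.1)%:M p.2 : 'rV_(1 + n).

Lemma cons_rVE0 n (p : R * 'rV[R]_n) : cons_rV p 0 0 = p.1.
Proof.
have := row_mxEl (p.1)%:M p.2 0 (0 : 'I_1).
rewrite [RHS]mxE eqxx mulr1n => <-; congr (row_mx _ _ _ _); exact: val_inj.
Qed.

Lemma cons_rVES n (p : R * 'rV[R]_n) i : cons_rV p 0 (lift ord0 i) = p.2 0 i.
Proof.
by rewrite -(row_mxEr (p.1)%:M p.2); congr (row_mx _ _ _ _); exact: val_inj.
Qed.

Lemma open_measurable_rV n (U : set 'rV[R]_n) : open U -> measurable U.
Proof. exact: sub_sigma_algebra. Qed.

Lemma nbhs_measurable_rV n (U : set 'rV[R]_n) :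
  (forall x, U x -> nbhs x U) -> measurable U.
Proof. by move=> Unbhs; apply: open_measurable_rV; rewrite openE. Qed.

Lemma measurable_cons_rV n : measurable_fun setT (@cons_rV n).
Proof.
apply: (@measurability _ _ _ _ _ _ (@open 'rV[R]_n.+1)) => //= _ [U oU <-]; rewrite setTI.
pose e (k : nat) : R := k.+1%:R^-1.
have e0 k : 0 < e k by rewrite invr_gt0.
pose B (i : rat * 'rV[rat]_n * nat) : set (R * 'rV[R]_n) :=
  ball (ratr i.1.1 : R) (e i.2) `*`
  [set v : 'rV[R]_n | forall j, ball (ratr (i.1.2 0 j) : R) (e i.2) (v 0 j)].
pose F i := if `[< B i `<=` @cons_rV n @^-1` U >] then B i else set0.
rewrite (_ : _ @^-1` _ = \bigcup_i F i).
  apply: countable_bigcupT_measurable; first exact: countableP.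
  move=> i; rewrite /F; case: ifPn => // _.
  apply: measurableX; first by apply: open_measurable; exact: ball_open.
  apply: nbhs_measurable_rV => v vi.
  exists (fun _ j => ball (ratr (i.1.2 0 j) : R) (e i.2)).
    move=> r j; rewrite ord1; apply: open_nbhs_nbhs; split; last exact: vi.
    exact: ball_open.
  by move=> w /= wi j; exact: wi.
apply/seteqP; split; last first.
  by move=> p [i _]; rewrite /F; case: asboolP => // /[apply].
move=> p Up.
have : nbhs (cons_rV p) U by exact: open_nbhs_nbhs.
move=> /nbhs_ballP[r /= r0 rU].
have [k kr] : exists k, e k < r / 2.
  exists (Num.truncn (r / 2)^-1); rewrite /e.
  rewrite -[ltRHS]invrK ltf_pV2 ?posrE ?invr_gt0 ?divr_gt0// ?ltr0n//.
  by rewrite truncnS_gt.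
have rd (x : R) : exists t : rat, ball (ratr t : R) (e k) x.
  have xx : x - e k < x + e k by have := e0 k; lra.
  have [t] := rat_in_itvoo xx.
  rewrite in_itv/= => tx; exists t; rewrite -ball_normE/=.
  by rewrite ltr_distl; move: tx; lra.
have cl (t x y : R) : ball t (e k) x -> ball t (e k) y -> ball x r y.
  move=> /ball_sym tx ty; apply: le_ball (ball_triangle tx ty).
  by move: kr; lra.
have [a pa] := rd p.1.
have /choice[v pv] : forall j, exists t : rat,
    ball (ratr t : R) (e k) (p.2 0 j) by move=> j; exact: rd.
exists (a, \row_j v j, k) => //.
have Bp : B (a, \row_j v j, k) p by split => //= j; rewrite mxE.
rewrite /F asboolT// => p' [/= p'1 p'2] /=.
apply: rU; split => // i j; rewrite ord1.
have [l ->|->] := unliftP ord0 j; last by rewrite !cons_rVE0; exact: cl pa p'1.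
by rewrite !cons_rVES; apply: cl (pv l) _; have := p'2 l; rewrite mxE.
Qed.


Definition uncons_rV n (x : 'rV[R]_n.+1) : R * 'rV[R]_n :=
  (x 0 0, \row_j x 0 (lift ord0 j)).

Lemma uncons_rVK n : cancel (@uncons_rV n) (@cons_rV n).
Proof.
move=> x; apply/rowP => i.
have [j ->|->] := unliftP ord0 i; last by rewrite cons_rVE0.
by rewrite cons_rVES mxE.
Qed.

Lemma cons_rVK n : cancel (@cons_rV n) (@uncons_rV n).
Proof.
move=> [a v]; congr pair; first exact: cons_rVE0.
by apply/rowP => j; rewrite mxE cons_rVES.
Qed.

Lemma measurable_uncons_rV n : measurable_fun setT (@uncons_rV n).
Proof.
apply: measurable_fun_pair.
  apply: (@measurability _ _ _ _ _ _ (@RGenOpens.G R)).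
    exact: RGenOpens.measurableE.
  move=> _ [_ [a [b ->] <-]].
  rewrite setTI; apply: nbhs_measurable_rV => x xab.
  exists (fun _ j => if j == 0 then `]a, b[%classic else setT).
    move=> i j; rewrite ord1; case: eqP => [->|_]; last exact: filterT.
    by apply: open_nbhs_nbhs; split => //; exact: interval_open.
  by move=> y /= /(_ 0 0); rewrite eqxx.
apply: (@measurability _ _ _ _ _ _ (@open 'rV[R]_n)) => //= _ [U oU <-].
rewrite setTI; apply: nbhs_measurable_rV => x Ux.
have [P xP PU] : nbhs (\row_j x 0 (lift ord0 j)) U by exact: open_nbhs_nbhs.
exists (fun i j => if unlift ord0 j is Some k then P i k else setT).
  move=> i j; case: unliftP => [k ->|_]; last exact: filterT.
  by have := xP i k; rewrite mxE ord1.
by move=> y /= Py; apply: PU => i j; have := Py i (lift ord0 j);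
  rewrite liftK mxE ord1.
Qed.

Section step.
Context n (m : {sigma_finite_measure set 'rV[R]_n -> \bar R}).

Definition lebesgue_step : set 'rV[R]_n.+1 -> \bar R :=
  pushforward (lebesgue_measure \x m)%E (@cons_rV n).

HB.instance Definition _ := Measure.copy lebesgue_step
  (measure_function_pushforward__canonical__measure_function_Measure
    (lebesgue_measure \x m)%E (@measurable_cons_rV n)).

Let sigma_finite_lebesgue_step : sigma_finite setT lebesgue_step.
Proof.
have /sigma_finiteP[F [FT Fnd Foo]] := sigma_finiteT (@lebesgue_measure R).
have /sigma_finiteP[G [GT Gnd Goo]] := sigma_finiteT m.
exists (fun k => @uncons_rV n @^-1` (F k `*` G k)).
  apply/seteqP; split => // x _.
  have : setT (x 0 0) by []. rewrite FT => -[i _ Fi].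
  have : setT (uncons_rV x).2 by []. rewrite GT => -[j _ Gj].
  exists (maxn i j) => //; split.
    by move: Fi; exact/subsetPset/Fnd/leq_maxl.
  by move: Gj; exact/subsetPset/Gnd/leq_maxr.
move=> k; have [mF Fk] := Foo k; have [mG Gk] := Goo k; split.
  rewrite -[X in measurable X]setTI; apply: measurable_uncons_rV => //.
  exact: measurableX.
rewrite /lebesgue_step /pushforward -comp_preimage.
rewrite (_ : _ @^-1` _ = F k `*` G k).
  by rewrite product_measure1E// lte_mul_pinfty// ge0_fin_numE.
have cK : @uncons_rV n \o @cons_rV n = id by apply/funext; exact: cons_rVK.
by rewrite cK.
Qed.

HB.instance Definition _ := Measure_isSigmaFinite.Build _ _ _ lebesgue_step
  sigma_finite_lebesgue_step.
End step.

(* L^n, by iterated products along R^(1 + n) = R * R^n *)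
Fixpoint lebesgue_rV n : {sigma_finite_measure set 'rV[R]_n -> \bar R} :=
  if n is n'.+1 then lebesgue_step (lebesgue_rV n') else dirac (0 : 'rV[R]_0).

End lebesgue_measure_rV.

Section density_measures.
Context (R : realType) (n : nat).
Implicit Types (A B C D Omega : set 'rV[R]_n) (f : 'rV[R]_n -> R).
Implicit Types (mu lambda : set 'rV[R]_n -> R).

Local Notation Ln := (lebesgue_rV R n).

(* The library norm on 'rV[R]_n is the sup norm. *)
Definition euclidean_norm (x : 'rV[R]_n) : R :=
  Num.sqrt (\sum_(i < n) x 0 i ^+ 2).

Definition neighborhood C (delta : R) : set 'rV[R]_n :=
  [set x | exists2 y, C y & euclidean_norm (x - y) < delta].

Definition density_set Omega C : Prop :=
  [/\ C `<=` closure Omega, C !=set0, closed C, Ln (C `&` Omega) = 0%E &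
      forall delta, 0 < delta -> (0 < Ln (neighborhood C delta `&` Omega))%E].

Definition borel_in Omega : set (set 'rV[R]_n) :=
  [set A | measurable A /\ A `<=` Omega].

(* A set function on B(Omega) is encoded as a function on all subsets of R^n,
   of which only the values on [borel_in Omega] are meaningful. *)
Definition ba Omega mu : Prop :=
  [/\ mu set0 = 0,
      forall A B, borel_in Omega A -> borel_in Omega B -> A `&` B = set0 ->
        mu (A `|` B) = mu A + mu B,
      exists M, forall A, borel_in Omega A -> `|mu A| <= M &
      forall A, borel_in Omega A -> Ln A = 0%E -> mu A = 0].

Definition nonnegative Omega mu : Prop :=
  forall A, borel_in Omega A -> 0 <= mu A.

Definition Dens Omega C mu : Prop :=
  [/\ ba Omega mu, nonnegative Omega mu &
      forall delta, 0 < delta ->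
        mu (neighborhood C delta `&` Omega) = mu Omega /\ mu Omega = 1].

(* Elements of L^oo(Omega) are given by representatives, which are bounded only
   almost everywhere; values outside Omega are irrelevant. *)
Definition Linfty Omega f : Prop :=
  measurable_fun Omega f /\
  exists M, {ae Ln, forall x, Omega x -> `|f x| <= M}.

Definition simple_integral mu D (s : {sfun 'rV[R]_n >-> R}) : R :=
  \sum_(y \in range s) y * mu (D `&` s @^-1` [set y]).

(* I is a limit of integrals of simple functions converging to f on D,
   uniformly up to null sets (i.e. in L^oo(D)) *)
Definition is_ba_integral mu D f (I : R) : Prop :=
  exists2 s : nat -> {sfun 'rV[R]_n >-> R},
    forall e, 0 < e -> \forall k \near \oo,
      {ae Ln, forall x, D x -> `|f x - s k x| <= e} &
    simple_integral mu D (s k) @[k --> \oo] --> I.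

(* For mu in ba(Omega), Borel D `<=` Omega and f in L^oo(Omega) there is exactly
   one such I; the default value 0 is not used. *)
Definition ba_integral mu D f : R := xget 0 (is_ba_integral mu D f).

Definition average Omega C lambda f (delta : R) : R :=
  (lambda (neighborhood C delta `&` Omega))^-1 *
  ba_integral lambda (neighborhood C delta `&` Omega) f.

End density_measures.

(* Main.v *)
Require Import Defs.
From mathcomp Require Import all_boot all_order all_algebra.
From mathcomp Require Import all_classical all_reals all_analysis.
From mathcomp Require Import measurable_realfun lra.

Import Order.TTheory GRing.Theory Num.Theory.
Import numFieldNormedType.Exports.
Local Open Scope classical_set_scope.
Local Open Scope ring_scope.

(** Let [D_d] be the trace on [Omega] of the [d]-neighborhood of [C].

    If [mu] is a density measure at [C], then [lambda := mu] works for a trivial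
    reason: [mu] lives on every [D_d], so that the average of [f] over [D_d]
    is the integral of [f] for every [d > 0] ([Dens_average]) and the limit
    superior is the limit of a constant.

    Conversely, let the integral against [mu] be bounded by the limit superior
    of the averages against some [lambda] ([Dens_of_limsup_bound]). Testing the
    bound with [- \1_A] shows that a lower bound of the averages of [\1_A],
    valid for small [d], is a lower bound of [mu A]. These averages are
    nonnegative, whence [mu >= 0]; they equal 1 for [A = D_e] as soon as
    [d < e], whence [mu D_e >= 1]. Testing with [\1_Omega] gives
    [mu Omega <= 1], and monotonicity squeezes both values to 1.

    The lower bound by the limit inferior is the upper bound applied to [- f].

    All this rests on the integral of a bounded function being well defined.
    The bounds [|mu A| <= M] only give [|mu|(D) <= 2 M] for the total variation
    ([ba_variation]), hence a Lipschitz estimate for the integral of simple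
    functions in the norm of L^oo ([simple_integral_lipschitz]). Uniqueness
    ([is_ba_integral_unique]) follows from it at once, and existence
    ([is_ba_integral_ex]) by completeness of [R], as simple functions are dense
    in L^oo ([Linfty_approx]). *)

(** * Finitely additive measures *)

Section ba_measure.
Context {R : realType} {n : nat}.
Implicit Types (A B D Omega : set 'rV[R]_n) (f : 'rV[R]_n -> R).
Implicit Types mu : set 'rV[R]_n -> R.

Local Notation Ln := (lebesgue_rV R n).

Lemma ba_sub Omega D mu : D `<=` Omega -> ba Omega mu -> ba D mu.
Proof.
move=> DO [mu0 muU [M muM] mu_ac].
have sub A : borel_in D A -> borel_in Omega A.
  by move=> [mA AD]; split => //; exact: subset_trans DO.
split => //.
- by move=> A B /sub bA /sub bB; exact: muU.
- by exists M => A /sub; exact: muM.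
- by move=> A /sub; exact: mu_ac.
Qed.

Lemma Linfty_sub Omega D f : measurable Omega -> D `<=` Omega ->
  Linfty Omega f -> Linfty D f.
Proof.
move=> mO DO [mf [M fM]]; split; first exact: measurable_funS mf.
by exists M; move: fM; apply: filterS => x fM /DO.
Qed.

Lemma ba_le Omega mu A B : ba Omega mu -> nonnegative Omega mu ->
  borel_in Omega A -> borel_in Omega B -> A `<=` B -> mu A <= mu B.
Proof.
move=> [_ muU _ _] mu_ge0 bA [mB BO] AB.
have bBA : borel_in Omega (B `\` A).
  by split; [apply: measurableD => //; exact: bA.1 | move=> x [/BO]].
rewrite -(setDUK AB) muU//; first by rewrite lerDl mu_ge0.
by rewrite setDIK.
Qed.

Lemma ba_bigcup Omega mu (I : choiceType) (r : seq I) (P : pred I)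
    (F : I -> set 'rV[R]_n) :
  ba Omega mu -> uniq r -> (forall i, borel_in Omega (F i)) ->
  trivIset setT F ->
  borel_in Omega (\big[setU/set0]_(i <- r | P i) F i) /\
  mu (\big[setU/set0]_(i <- r | P i) F i) = \sum_(i <- r | P i) mu (F i).
Proof.
move=> [mu0 muU _ _] + bF tF; elim: r => [_|i r IH /=].
  by rewrite !big_nil; split => //; split => //; exact: measurable0.
move=> /andP[ir /IH[bU muE]].
rewrite !big_cons; case: ifP => // Pi; split.
  split; first by apply: measurableU; [exact: (bF i).1|exact: bU.1].
  by move=> x [/(bF i).2|/bU.2].
rewrite muU// ?muE// -subset0 => x [Fix].
rewrite -bigcup_seq_cond => -[j /= /andP[jr _] Fjx].
move/negP: ir; apply; suff -> : i = j by [].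
by apply: tF => //; exists x.
Qed.

(** Grouping the pieces by the sign of their measure turns the sum into the
    difference of the measures of two sets, each bounded by [M]. *)
Lemma ba_variation {Omega mu} (M : R) (I : choiceType) (r : seq I)
    (F : I -> set 'rV[R]_n) :
  ba Omega mu -> (forall A, borel_in Omega A -> `|mu A| <= M) ->
  uniq r -> (forall i, borel_in Omega (F i)) -> trivIset setT F ->
  \sum_(i <- r) `|mu (F i)| <= 2 * M.
Proof.
move=> bamu muM ur bF tF.
rewrite (bigID (fun i => 0 <= mu (F i)))/=.
rewrite (eq_bigr (fun i => mu (F i))); last by move=> i /ger0_norm.
rewrite [X in _ + X](eq_bigr (fun i => - mu (F i))); last first.
  by move=> i; rewrite -ltNge => /ltr0_norm.
rewrite sumrN.
have [bP <-] := ba_bigcup Omega mu I r (fun i => 0 <= mu (F i)) F bamu ur bF tF.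
have [bN <-] :=
  ba_bigcup Omega mu I r (fun i => ~~ (0 <= mu (F i))) F bamu ur bF tF.
have := muM _ bP; have := muM _ bN; rewrite !ler_norml; lra.
Qed.

End ba_measure.

(** * The integral of essentially bounded functions *)

Section ba_integral_theory.
Import HBSimple.
Context {R : realType} {n : nat}.
Implicit Types (A B D Omega : set 'rV[R]_n) (f : 'rV[R]_n -> R).
Implicit Types (mu : set 'rV[R]_n -> R) (s t : {sfun 'rV[R]_n >-> R}).

Local Notation Ln := (lebesgue_rV R n).

(** Any finite list of potential values can serve as index set, so that several
    simple functions can be decomposed along the same list. *)
Lemma simple_integral_seq mu D s (r : seq R) : mu set0 = 0 ->
  uniq r -> range s `<=` [set` r] ->
  simple_integral mu D s = \sum_(y <- r) y * mu (D `&` s @^-1` [set y]).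
Proof.
move=> mu0 ur sr; rewrite /simple_integral (fsbig_widen _ [set` r])//.
  by rewrite -fsbig_seq.
move=> y [_ /= ys]; rewrite (_ : _ `&` _ = set0) ?mu0 ?mulr0//.
by rewrite -subset0 => x [_ /= sx]; apply: ys; exists x.
Qed.

Lemma sfun_range_seq s : exists2 r : seq R, uniq r & range s `<=` [set` r].
Proof.
have /finite_seqP[r rs] := fimfunP s.
by exists (undup r); rewrite ?undup_uniq// rs => y /=; rewrite mem_undup.
Qed.

Lemma ba_partition Omega mu A s (r : seq R) : ba Omega mu ->
  borel_in Omega A -> uniq r -> range s `<=` [set` r] ->
  mu A = \sum_(y <- r) mu (A `&` s @^-1` [set y]).
Proof.
move=> bamu [mA AO] ur sr.
have bF y : borel_in Omega (A `&` s @^-1` [set y]).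
  split; last by move=> x [/AO].
  by apply: measurableI => //; exact: measurable_funPTI.
have tF : trivIset setT (fun y => A `&` s @^-1` [set y]).
  by move=> y z _ _ [x [[_ /= <-] [_ /= <-]]].
have [_ <-] := ba_bigcup Omega mu _ r xpredT _ bamu ur bF tF.
congr mu; rewrite -bigcup_seq; apply/seteqP; split => [x Ax|x [y _ []]//].
by exists (s x); [apply: sr; exists x|split].
Qed.

(** Both integrals are sums over the common refinement
    [F (y, z) = D `&` s @^-1` [set y] `&` t @^-1` [set z]], and their difference
    is the sum of the [(y - z) * mu (F (y, z))]. Either [|y - z| <= e], or
    [F (y, z)] is a null set; in both cases the term is at most
    [e * |mu (F (y, z))|], and the total variation bound applies. *)
Lemma simple_integral_lipschitz {D mu} (M : R) (e : R) s t : measurable D ->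
  ba D mu -> (forall A, borel_in D A -> `|mu A| <= M) -> 0 <= e ->
  {ae Ln, forall x, D x -> `|s x - t x| <= e} ->
  `|simple_integral mu D s - simple_integral mu D t| <= e * (2 * M).
Proof.
move=> mD bamu muM e0 st.
have [mu0 _ _ mu_ac] := bamu.
have [rs us sr] := sfun_range_seq s; have [rt ut tr] := sfun_range_seq t.
have bs (u : {sfun 'rV[R]_n >-> R}) y A :
    borel_in D A -> borel_in D (A `&` u @^-1` [set y]).
  move=> [mA AD]; split; last by move=> x [/AD].
  by apply: measurableI => //; exact: measurable_funPTI.
have bD : borel_in D D by split.
pose F (p : R * R) := D `&` s @^-1` [set p.1] `&` t @^-1` [set p.2].
have bF p : borel_in D (F p) by exact: bs _ _ _ (bs _ _ _ bD).
have -> : simple_integral mu D s =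
    \sum_(p <- [seq (y, z) | y <- rs, z <- rt]) p.1 * mu (F p).
  rewrite big_allpairs (simple_integral_seq mu D s rs)//.
  apply: eq_bigr => y _.
  by rewrite -big_distrr/= (ba_partition D mu _ t rt)//.
have -> : simple_integral mu D t =
    \sum_(p <- [seq (y, z) | y <- rs, z <- rt]) p.2 * mu (F p).
  rewrite big_allpairs exchange_big/= (simple_integral_seq mu D t rt)//.
  apply: eq_bigr => z _; rewrite -big_distrr/= (ba_partition D mu _ s rs)//.
  by under eq_bigr do rewrite /F setIAC.
rewrite -sumrB; apply: (le_trans (ler_norm_sum _ _ _)).
apply: (@le_trans _ _
    (\sum_(p <- [seq (y, z) | y <- rs, z <- rt]) e * `|mu (F p)|)).
  apply: ler_sum => -[y z] _ /=; rewrite -mulrBl normrM.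
  have [yz|yz] := leP `|y - z| e; first by rewrite ler_wpM2r.
  suff -> : mu (F (y, z)) = 0 by rewrite normr0 !mulr0.
  apply: mu_ac; first exact: bF.
  apply: measure_negligible; first exact: (bF _).1.
  apply: negligibleS st => x [[Dx /= sx] /= tx] /(_ Dx).
  by rewrite sx tx leNgt yz.
rewrite -mulr_sumr ler_wpM2l//.
apply: (ba_variation M) bamu muM _ _ _.
- apply: allpairs_uniq => //; first by move=> [a b] [c d].
- exact: bF.
- by move=> [y z] [y' z'] _ _ [x [[[_ /= <-] /= <-] [[_ /= <-] /= <-]]].
Qed.

(** Two approximating sequences of the same [f] are eventually [2 d]-close to
    each other for every [d > 0], hence so are their integrals, up to a
    constant factor. *)
Lemma is_ba_integral_unique {D mu f} (I J : R) : measurable D -> ba D mu ->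
  is_ba_integral mu D f I -> is_ba_integral mu D f J -> I = J.
Proof.
move=> mD bamu [s fs sI] [t ft tJ].
have [_ _ [M muM] _] := bamu.
apply/eqP; rewrite -subr_eq0; apply/eqP.
apply: (cvg_unique _ (cvgB sI tJ)) => //.
apply/cvgr0Pnorm_le => e e0.
(* [M] may be 0: the summand 1 keeps the denominator positive. *)
pose d := e / (4 * (`|M| + 1)).
have M1 : 0 < 4 * (`|M| + 1) by rewrite mulr_gt0// ltr_wpDl.
have d0 : 0 < d by rewrite divr_gt0.
near=> k.
have fsk : {ae Ln, forall x, D x -> `|f x - s k x| <= d} by near: k; exact: fs.
have ftk : {ae Ln, forall x, D x -> `|f x - t k x| <= d} by near: k; exact: ft.
apply: (@le_trans _ _ ((d + d) * (2 * `|M|))).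
  apply: simple_integral_lipschitz => //.
  - by move=> A bA; exact: le_trans (muM _ bA) (ler_norm _).
  - by rewrite addr_ge0// ltW.
  - move: fsk ftk; apply: filterS2 => x sx tx Dx.
    have -> : s k x - t k x = (f x - t k x) - (f x - s k x) by lra.
    by apply: le_trans (ler_normB _ _) _; apply: lerD; auto.
have -> : (d + d) * (2 * `|M|) = e * (4 * `|M| / (4 * (`|M| + 1))).
  by rewrite /d; lra.
by rewrite ler_piMr ?(ltW e0)// ler_pdivrMr// mul1r; lra.
Unshelve. all: by end_near.
Qed.

Lemma ba_integralE {D mu f} (I : R) : measurable D -> ba D mu ->
  is_ba_integral mu D f I -> ba_integral mu D f = I.
Proof.
move=> mD bamu fI; apply: (is_ba_integral_unique _ _ mD bamu (f := f)) => //.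
by apply: xgetPex; exists I.
Qed.

Lemma truncn_count (N : nat) (t : R) : t <= N%:R ->
  \sum_(j < N) (if (j.+1%:R <= t) then 1 else 0) = (Num.truncn t)%:R :> R.
Proof.
move=> tN; have qN : (Num.truncn t <= N)%N.
  by have := le_truncn tN; rewrite natrK.
rewrite -big_mkcond/=; under eq_bigl do rewrite -truncn_gt_nat.
by rewrite -(big_ord_widen N (fun=> 1) qN) sumr_const card_ord.
Qed.

(** The approximation is [e * truncn ((f + M) / e) - M], the rounding of [f]
    downwards to the grid [- M + e * nat]. Counting the levels below [f]
    ([truncn_count]) exhibits it as a combination of finitely many indicators of
    superlevel sets of [f]. *)
Lemma Linfty_approx {D f} (e : R) : measurable D -> Linfty D f -> 0 < e ->
  exists s, {ae Ln, forall x, D x -> `|f x - s x| <= e}.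
Proof.
move=> mD [mf [M fM]] e0.
pose N := (Num.truncn (2 * M / e)).+1.
pose A (j : nat) := D `&` f @^-1` `[(j.+1%:R * e - M), +oo[%classic.
have mA j : measurable (A j) by apply: mf => //; exact: measurable_itv.
exists (\sum_(j < N) scale_sfun e (indic_sfun _ (mA j)) - cst_sfun M).
move: fM; apply: filterS => x fM Dx; have := fM Dx.
rewrite ler_norml => /andP[Mf fM'].
pose t := (f x + M) / e.
have t0 : 0 <= t by apply: divr_ge0; lra.
have tN : t <= N%:R.
  apply: (@le_trans _ _ (2 * M / e)); last exact/ltW/truncnS_gt.
  by rewrite ler_pM2r ?invr_gt0//; lra.
rewrite sfunB/= sfun_sum.
rewrite (eq_bigr (fun j : 'I_N => e * (if j.+1%:R <= t then 1 else 0))).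
  rewrite -mulr_sumr truncn_count//.
  have /andP[lo hi] := truncn_itv t0.
  have fE : f x = t * e - M by rewrite /t divfK ?gt_eqF//; lra.
  rewrite fE ler_norml; move: hi; rewrite -natr1; nra.
move=> j _; rewrite /= mulrC; congr (e * _).
rewrite /mindic indicE (_ : (x \in A j) = (j.+1%:R <= t)); first by case: ifP.
rewrite /t ler_pdivlMr// -lerBlDr.
by apply/idP/idP => [/set_mem[_ /=]|le]; [|apply/mem_set; split => //=];
  rewrite in_itv/= andbT.
Qed.

(** By the Lipschitz estimate, the integrals of simple functions converging to
    [f] form a Cauchy sequence. *)
Lemma is_ba_integral_ex {D mu f} : measurable D -> ba D mu -> Linfty D f ->
  exists I, is_ba_integral mu D f I.
Proof.
move=> mD bamu Lf.
have e0 (k : nat) : 0 < k.+1%:R^-1 :> R by rewrite invr_gt0.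
have /choice[s fs] : forall k : nat, exists s,
    {ae Ln, forall x, D x -> `|f x - s x| <= k.+1%:R^-1}.
  by move=> k; exact: Linfty_approx.
have [_ _ [M muM] _] := bamu.
suff /cvg_ex[I sI] : cvg (simple_integral mu D (s k) @[k --> \oo]).
  exists I, s => // e e0'; near=> k.
  move: (fs k); apply: filterS => x /[apply] /le_trans; apply.
  by near: k; apply: filterS (near_infty_natSinv_lt (PosNum e0')) => k /ltW.
apply/cauchy_cvgP/cauchy_exP => e e0'.
pose K := 4 * (`|M| + 1).
have K0 : 0 < K by rewrite mulr_gt0// ltr_wpDl.
have eK0 : 0 < e / K by rewrite divr_gt0.
have [N _ NP] := near_infty_natSinv_lt (PosNum eK0).
exists (simple_integral mu D (s N)); exists N => // k Nk /=.
rewrite -ball_normE /=.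
have Ne := NP N (leqnn N); have ke := NP k Nk; rewrite /= in Ne ke.
apply: (@le_lt_trans _ _ ((N.+1%:R^-1 + k.+1%:R^-1) * (2 * `|M|))).
  apply: simple_integral_lipschitz => //.
  - by move=> A bA; exact: le_trans (muM _ bA) (ler_norm _).
  - move: (fs N) (fs k); apply: filterS2 => x sx tx Dx.
    have -> : s N x - s k x = (f x - s k x) - (f x - s N x) by lra.
    apply: le_trans (ler_normB _ _) _; rewrite addrC.
    by apply: lerD; auto.
apply: (@le_lt_trans _ _ ((e / K + e / K) * (2 * `|M|))).
  by rewrite ler_wpM2r ?mulr_ge0// lerD// ltW.
have -> : (e / K + e / K) * (2 * `|M|) = e * (4 * `|M| / K) by lra.
by rewrite gtr_pMr// ltr_pdivrMr// mul1r /K; lra.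
Unshelve. all: by end_near.
Qed.

Lemma ba_integralP {D mu f} : measurable D -> ba D mu -> Linfty D f ->
  is_ba_integral mu D f (ba_integral mu D f).
Proof.
by move=> mD bamu /(is_ba_integral_ex mD bamu)[I DI]; apply: xgetPex; exists I.
Qed.

Lemma simple_integralN mu D s : mu set0 = 0 ->
  simple_integral mu D (- s) = - simple_integral mu D s.
Proof.
move=> mu0; have [r ur sr] := sfun_range_seq s.
rewrite (simple_integral_seq mu D s r)//.
rewrite (simple_integral_seq mu D (- s) [seq - y | y <- r])//.
- rewrite big_map -sumrN; apply: eq_bigr => y _; rewrite mulNr.
  congr (- (_ * mu (_ `&` _))); apply/seteqP; split => x /=.
    by move/oppr_inj.
  by move=> <-.
- by rewrite map_inj_uniq//; exact: oppr_inj.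
- by move=> _ [x _ <-] /=; apply: (map_f -%R); apply: sr; exists x.
Qed.

Lemma is_ba_integralN {D mu f I} : mu set0 = 0 ->
  is_ba_integral mu D f I -> is_ba_integral mu D (\- f) (- I).
Proof.
move=> mu0 [s fs sI]; exists (fun k => - s k).
  move=> e /fs; apply: filterS => k; apply: filterS => x /[apply].
  by rewrite -normrN; congr (`|_| <= _); rewrite /= opprB opprK addrC.
by under eq_fun do rewrite simple_integralN//; exact: cvgN.
Qed.

Lemma ba_integralN {D mu f} : measurable D -> ba D mu -> Linfty D f ->
  ba_integral mu D (\- f) = - ba_integral mu D f.
Proof.
move=> mD bamu Lf; apply: ba_integralE => //.
by have [mu0 _ _ _] := bamu; exact/is_ba_integralN/ba_integralP.
Qed.

Lemma LinftyN D f : Linfty D f -> Linfty D (\- f).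
Proof.
move=> [mf [M fM]]; split; first exact: measurable_funN.
by exists M; move: fM; apply: filterS => x; rewrite normrN.
Qed.

Lemma Linfty_indic D A : measurable A -> Linfty D (\1_A : 'rV[R]_n -> R).
Proof.
move=> mA; split; first exact: measurable_indic.
exists 1; apply: aeW => x _; rewrite indicE; case: (_ \in _) => /=.
  by rewrite normr1.
by rewrite normr0.
Qed.

Lemma ba_integral_indic {D mu A} : measurable D -> ba D mu -> measurable A ->
  ba_integral mu D \1_A = mu (D `&` A).
Proof.
move=> mD bamu mA; apply: ba_integralE => //; have [mu0 _ _ _] := bamu.
exists (fun=> indic_sfun _ mA).
  by move=> e e0; near=> k; apply: aeW => x _; rewrite subrr normr0 ltW.
under eq_fun.
  move=> k; rewrite (simple_integral_seq _ _ _ [:: 0; 1])//=; last 2 first.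
  - by rewrite !inE eq_sym oner_eq0.
  - move=> _ [x _ <-]; rewrite /= !inE /mindic/= indicE.
    by case: (_ \in _); rewrite eqxx ?orbT.
  rewrite !big_cons big_nil mul0r mul1r add0r addr0.
  rewrite (_ : _ @^-1` [set 1] = A) ?over//.
  apply/seteqP; split => x /=; rewrite /mindic/= indicE.
    by case: (boolP (x \in A)) => [/set_mem//|_ /eqP]; rewrite eq_sym oner_eq0.
  by move=> /mem_set ->.
exact: cvg_cst.
Unshelve. all: by end_near.
Qed.

(** A nonnegative measure with [mu D = mu Omega] vanishes on the Borel subsets
    of [Omega `\` D], so that simple functions have the same integral over both
    sets and the same approximating sequence serves for both. *)
Lemma ba_integral_restrict {Omega D mu f} :
  measurable Omega -> measurable D -> D `<=` Omega ->
  ba Omega mu -> nonnegative Omega mu -> mu D = mu Omega -> Linfty Omega f ->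
  ba_integral mu D f = ba_integral mu Omega f.
Proof.
move=> mO mD DO bamu mu0 muD Lf.
have [_ muU _ _] := bamu.
apply: ba_integralE => //; first exact: ba_sub bamu.
have [s fs sI] := ba_integralP mO bamu Lf; exists s.
  move=> e /fs; apply: filterS => k; apply: filterS => x fsx /DO; exact: fsx.
rewrite (_ : (fun k => _) = (fun k => simple_integral mu Omega (s k)))//.
apply/funext => k; apply: eq_fsbigr => y _; congr (y * _).
set A := s k @^-1` [set y].
have mA : measurable A by exact: measurable_funPTI.
have bDA : borel_in Omega (D `&` A).
  by split; [exact: measurableI|move=> x [/DO]].
have bODA : borel_in Omega ((Omega `\` D) `&` A).
  by split; [apply: measurableI => //; exact: measurableD|move=> x [[]]].
have bOD : borel_in Omega (Omega `\` D).
  by split; [exact: measurableD|move=> x []].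
have OD0 : mu (Omega `\` D) = 0.
  have := muU D (Omega `\` D) (conj mD DO) bOD (setDIK _ _).
  rewrite setDUK// -muD; lra.
have ODA0 : mu ((Omega `\` D) `&` A) = 0.
  apply/eqP; rewrite eq_le mu0// andbT -OD0.
  by apply: (ba_le Omega) => // x [].
rewrite -[in RHS](setDUK DO) setIUl muU// ?ODA0 ?addr0//.
by rewrite -subset0 => x [[Dx _] [[_]]].
Qed.

End ba_integral_theory.

(** * Neighborhoods, limits superior and averages *)

Section neighborhoods.
Context {R : realType} {n : nat}.
Implicit Types (C : set 'rV[R]_n).

Lemma open_neighborhood C (d : R) : open (neighborhood C d).
Proof.
have -> : neighborhood C d =
    \bigcup_(y in C) [set x | euclidean_norm (x - y) < d].
  by apply/seteqP; split => x [y Cy xy]; exists y.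
apply: bigcup_open => y _.
change (open ((fun x : 'rV[R]_n => euclidean_norm (x - y)) @^-1`
  [set u | u < d])).
apply: open_comp; last exact: open_lt.
move=> x _.
have csum : continuous (fun x : 'rV[R]_n => \sum_(i < n) (x - y) 0 i ^+ 2).
  apply: (continuous_big add_continuous) => i _ z.
  have cxy : {for z, continuous (fun x : 'rV[R]_n => (x - y) 0 i)}.
    have -> : (fun x : 'rV[R]_n => (x - y) 0 i) = (fun x => x 0 i - y 0 i).
      by apply/funext => u; rewrite !mxE.
    exact: cvgB (@coord_continuous _ _ _ 0 i z) (cvg_cst _).
  exact: continuous_comp cxy (@exprn_continuous _ 2 _).
exact: continuous_comp (csum x) (@sqrt_continuous _ _).
Qed.

End neighborhoods.

Lemma limf_esup_le (R : realType) (X : choiceType) (T : filteredType X)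
    (f : T -> \bar R) (F : set_system T) (c : \bar R) :
  (\forall x \near F, (f x <= c)%E) -> (limf_esup f F <= c)%E.
Proof.
move=> Fc; rewrite limf_esupE; apply: ge_ereal_inf.
pose V := [set x | (f x <= c)%E].
exists (ereal_sup (f @` V)); first by exists V.
by apply: ge_ereal_sup => _ [x /= fxc <-].
Qed.

Lemma ge_limf_esup (R : realType) (X : choiceType) (T : filteredType X)
    (f : T -> \bar R) (F : set_system T) (c : \bar R) : ProperFilter F ->
  (\forall x \near F, (c <= f x)%E) -> (c <= limf_esup f F)%E.
Proof.
move=> FF Fc; rewrite limf_esupE; apply: le_ereal_inf_tmp => _ [V FV <-].
have [x [Vx cx]] := filter_ex (filterI FV Fc).
by apply: le_ereal_sup_tmp; exists (f x) => //; exists x.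
Qed.

Section averages.
Context {R : realType} {n : nat}.
Implicit Types (A C Omega : set 'rV[R]_n) (f : 'rV[R]_n -> R).
Implicit Types mu lambda : set 'rV[R]_n -> R.

Lemma measurable_neighborhoodI C Omega (d : R) : measurable Omega ->
  measurable (neighborhood C d `&` Omega).
Proof.
move=> mO; apply: measurableI => //.
apply: open_measurable_rV; apply: open_neighborhood.
Qed.

Lemma averageN Omega C lambda f (d : R) : measurable Omega ->
  ba Omega lambda -> Linfty Omega f ->
  average Omega C lambda (\- f) d = - average Omega C lambda f d.
Proof.
move=> mO bal Lf; rewrite /average ba_integralN ?mulrN//.
- exact: measurable_neighborhoodI.
- by apply: ba_sub bal.
- by apply: Linfty_sub Lf.
Qed.

Lemma average_indic Omega C lambda A (d : R) : measurable Omega ->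
  ba Omega lambda -> measurable A ->
  average Omega C lambda \1_A d =
  (lambda (neighborhood C d `&` Omega))^-1 *
  lambda (neighborhood C d `&` Omega `&` A).
Proof.
move=> mO bal mA; rewrite /average ba_integral_indic//.
- exact: measurable_neighborhoodI.
- by apply: ba_sub bal.
Qed.

(** The form in which the hypothesis on the limit superior is used: only the
    averages for small [d] matter. *)
Lemma ba_integral_le_average Omega C mu lambda f (c e : R) : 0 < e ->
  ((ba_integral mu Omega f)%:E <=
    limf_esup (fun d : R => (average Omega C lambda f d)%:E) 0^'+)%E ->
  (forall d : R, 0 < d -> d < e -> average Omega C lambda f d <= c) ->
  ba_integral mu Omega f <= c.
Proof.
move=> e0 If fc; rewrite -lee_fin; apply: le_trans If _.
apply: limf_esup_le; near=> d; rewrite lee_fin; apply: fc.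
- by near: d; exact: nbhs_right_gt.
- by near: d; exact: nbhs_right_lt.
Unshelve. all: by end_near.
Qed.

Lemma neighborhood_sub C (d e : R) : d <= e ->
  neighborhood C d `<=` neighborhood C e.
Proof. by move=> de x [y Cy xy]; exists y => //; exact: lt_le_trans de. Qed.

Lemma Dens_average Omega C mu f (d : R) : measurable Omega ->
  Dens Omega C mu -> Linfty Omega f -> 0 < d ->
  average Omega C mu f d = ba_integral mu Omega f.
Proof.
move=> mO [bamu mu0 muC] Lf d0; have [muCd mu1] := muC d d0.
rewrite /average muCd mu1 invr1 mul1r; apply: ba_integral_restrict => //.
exact: measurable_neighborhoodI.
Qed.

Lemma Dens_of_limsup_bound Omega C mu lambda : measurable Omega ->
  ba Omega mu -> ba Omega lambda -> nonnegative Omega lambda ->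
  (forall d : R, 0 < d -> 0 < lambda (neighborhood C d `&` Omega)) ->
  (forall f, Linfty Omega f ->
    ((ba_integral mu Omega f)%:E <=
     limf_esup (fun d : R => (average Omega C lambda f d)%:E) 0^'+)%E) ->
  Dens Omega C mu.
Proof.
move=> mO bamu bal l0 lC mul.
have bC d : borel_in Omega (neighborhood C d `&` Omega).
  by split; [exact: measurable_neighborhoodI|move=> x []].
(* The test function is [- \1_A]. *)
have lower A (c e : R) : borel_in Omega A -> 0 < e ->
    (forall d : R, 0 < d -> d < e -> c <= average Omega C lambda \1_A d) ->
    c <= mu A.
  move=> [mA AO] e0 Ac; rewrite -(setIidr AO) -ba_integral_indic//.
  have LA : Linfty Omega (\1_A : 'rV[R]_n -> R) by exact: Linfty_indic.
  rewrite -lerN2 -ba_integralN//.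
  apply: (ba_integral_le_average Omega C mu lambda _ _ e) => //.
    exact/mul/LinftyN.
  by move=> d d0 de; rewrite averageN// lerN2 Ac.
have mu0 : nonnegative Omega mu.
  move=> A bA; apply: (lower A 0 1) => // d d0 _.
  rewrite average_indic//; last exact: bA.1.
  rewrite mulr_ge0 ?invr_ge0 ?(ltW (lC d d0))//; apply: l0; split.
    by apply: measurableI; [exact: (bC d).1|exact: bA.1].
  by move=> x [[]].
have muC d : 0 < d -> 1 <= mu (neighborhood C d `&` Omega).
  move=> d0; apply: (lower _ 1 d) => // d' d'0 /ltW d'd.
  rewrite average_indic//; last exact: (bC d).1.
  rewrite (setIidl (B := neighborhood C d `&` Omega)).
    by rewrite mulVf// gt_eqF// lC.
  by move=> x [/(neighborhood_sub _ _ _ d'd)].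
have mu1 : mu Omega <= 1.
  rewrite -[X in mu X]setIid -ba_integral_indic//.
  apply: (ba_integral_le_average Omega C mu lambda _ _ 1) => //.
    exact/mul/Linfty_indic.
  move=> d d0 _; rewrite average_indic// -setIA setIid.
  by rewrite mulVf// gt_eqF// lC.
split => // d d0.
have muCO : mu (neighborhood C d `&` Omega) <= mu Omega.
  by apply: (ba_le Omega) => //; split.
have := muC d d0; split; apply/eqP; rewrite eq_le; apply/andP; split; lra.
Qed.

End averages.

Theorem theorem3p9 (R : realType) (n : nat) (Omega C : set 'rV[R]_n)
    (mu : set 'rV[R]_n -> R)
    (mOmega : measurable Omega) (dC : density_set Omega C) (bamu : ba Omega mu) :
  (Dens Omega C mu <->
   exists lambda : set 'rV[R]_n -> R,
     [/\ ba Omega lambda, nonnegative Omega lambda,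
         (forall delta : R, 0 < delta ->
            0 < lambda (neighborhood C delta `&` Omega)) &
         (forall f : 'rV[R]_n -> R, Linfty Omega f ->
            ((ba_integral mu Omega f)%:E <=
             limf_esup (fun delta : R => (average Omega C lambda f delta)%:E)
               0^'+)%E)]) /\
  (forall lambda : set 'rV[R]_n -> R,
     ba Omega lambda -> nonnegative Omega lambda ->
     (forall delta : R, 0 < delta ->
        0 < lambda (neighborhood C delta `&` Omega)) ->
     (forall f : 'rV[R]_n -> R, Linfty Omega f ->
        ((ba_integral mu Omega f)%:E <=
         limf_esup (fun delta : R => (average Omega C lambda f delta)%:E)
           0^'+)%E) ->
     forall f : 'rV[R]_n -> R, Linfty Omega f ->
       (limf_einf (fun delta : R => (average Omega C lambda f delta)%:E) 0^'+ <=
        (ba_integral mu Omega f)%:E)%E).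
Proof.
split; [split => [muC|[lambda [bal l0 lC mul]]]|].
- exists mu; have [_ mu0 muCd] := muC; split => //.
    by move=> d /muCd[-> ->].
  move=> f Lf; apply: ge_limf_esup; near=> d.
  by rewrite lee_fin (Dens_average Omega C mu f d).
- exact: Dens_of_limsup_bound bamu bal l0 lC mul.
- move=> lambda bal l0 lC mul f Lf.
  rewrite /limf_einf leeNl -EFinN -ba_integralN//.
  have := mul _ (LinftyN _ _ Lf); congr (_ <= limf_esup _ _)%E.
  by apply/funext => d; rewrite averageN.
Unshelve. all: by end_near.
Qed.
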